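(* Let $\mathcal{N}=\{1,\dots,N\}$ and let $u:2^{\mathcal{N}}\times\Delta\to\mathbb{R}$ be an uncertain value function, where the value $u(\mathcal{N})$ of the grand coalition does not depend on $\delta$. Let $\delta_K=\{\delta^{(1)},\dots,\delta^{(K)}\}$ be $K$ i.i.d. samples drawn from $\Delta$ according to $\mathbb{P}$, and assume that for every multi-sample $\delta_K\in\Delta^K$ the scenario core $C(G_K)$ is non-empty. Fix a confidence parameter $\beta\in(0,1)$ and let $\epsilon:\{0,\dots,K\}\to[0,1]$ be any function such that $$\epsilon(K)=1\quad\text{and}\quad \sum_{s=0}^{K-1}\binom{K}{s}(1-\epsilon(s))^{K-s}=\beta .$$ Then $$\mathbb{P}^K\left\{\delta_K\in\Delta^K \;\middle|\; \mathbb{V}(C(G_K))>\epsilon(s_K)\right\}\le\beta,$$ where $\mathbb{P}^K=\prod_{k=1}^K\mathbb{P}$ and $s_K$ is the cardinality of a minimal compression set of the algorithm $A$ for the multi-sample $\delta_K$.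
   Context: An uncertain cooperative game has agents $\mathcal{N}=\{1,\dots,N\}$, an uncertain parameter $\delta$ taking values in a set $\Delta$ according to a (fixed, possibly unknown) probability distribution $\mathbb{P}$, and a value function $u:2^{\mathcal{N}}\times\Delta\to\mathbb{R}$; an allocation is a vector $\boldsymbol{x}=(x_1,\dots,x_N)\in\mathbb{R}^N$. Given samples $\delta_K=\{\delta^{(1)},\dots,\delta^{(K)}\}$, the scenario core is $$C(G_K)=\Big\{\boldsymbol{x}\in\mathbb{R}^N \,\Big|\, \textstyle\sum_{i\in\mathcal{N}}x_i=u(\mathcal{N}),\ \sum_{i\in S}x_i\ge \max_{k=1,\dots,K}u(S,\delta^{(k)})\ \text{for all } S\subsetneq\mathcal{N}\Big\}.$$ The probability of core instability of the scenario core is $$\mathbb{V}(C(G_K))=\mathbb{P}\Big\{\delta\in\Delta \,\Big|\, \exists\,\boldsymbol{x}\in C(G_K),\ \exists\, S\subsetneq\mathcal{N}:\ \textstyle\sum_{i\in S}x_i<u(S,\delta)\Big\}.$$ The algorithm $A$ is the map taking a finite collection of samples to the scenario core built from those samples; in particular $A(\delta_K)=C(G_K)$. A subset $I\subseteq\delta_K$ is a compression set if $A(I)=A(\delta_K)$ (i.e., the scenario core built from the samples in $I$ alone equals $C(G_K)$); a minimal compression set is a compression set of minimal cardinality. *)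

(* Defs.v *)
From HB Require Import structures.
From mathcomp Require Import all_boot all_order all_algebra.
From mathcomp Require Import all_classical all_reals all_analysis.
Set Implicit Arguments. Unset Strict Implicit. Unset Printing Implicit Defensive.
Import Order.TTheory GRing.Theory Num.Theory.
Local Open Scope classical_set_scope.
Local Open Scope ring_scope.

Definition scenario_core (R : realType) (N : nat) (Delta : Type)
  (u : {set 'I_N} -> Delta -> R) (uN : R) (D : set Delta) : set ('I_N -> R) :=
  [set x | \sum_(i < N) x i = uN /\
           forall S : {set 'I_N}, S != [set: 'I_N]%SET ->
             forall delta, D delta -> u S delta <= \sum_(i in S) x i].

Definition samples_of (Delta : Type) (K : nat) (w : K.-tuple Delta)
  (I : {set 'I_K}) : set Delta :=
  [set delta | exists2 k : 'I_K, k \in I & delta = tnth w k].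

Definition alg (R : realType) (N : nat) (Delta : Type)
  (u : {set 'I_N} -> Delta -> R) (uN : R) (K : nat) (w : K.-tuple Delta)
  (I : {set 'I_K}) : set ('I_N -> R) :=
  scenario_core u uN (samples_of w I).

Definition instability_set (R : realType) (N : nat) (Delta : Type)
  (u : {set 'I_N} -> Delta -> R) (C : set ('I_N -> R)) : set Delta :=
  [set delta | exists x, C x /\ exists S : {set 'I_N},
      S != [set: 'I_N]%SET /\ \sum_(i in S) x i < u S delta].

Definition prob_instability (R : realType) (d : measure_display)
  (Delta : measurableType d) (P : probability Delta R) (N : nat)
  (u : {set 'I_N} -> Delta -> R) (C : set ('I_N -> R)) : \bar R :=
  P (instability_set u C).

Definition min_compression_size (R : realType) (N : nat) (Delta : Type)
  (u : {set 'I_N} -> Delta -> R) (uN : R) (K : nat) (w : K.-tuple Delta) : nat :=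
  \big[minn/K]_(I : {set 'I_K} | `[< alg u uN w I = alg u uN w [set: 'I_K]%SET >]) #|I|.

(* Main.v *)
(** If [I] compresses the multi-sample [w], then every sample outside [I] avoids
    the instability set of the core built on [I]. Given the samples in [I], the
    others are independent of that set, so the event that it also has probability
    more than [eps #|I|] has probability at most [(1 - eps #|I|) ^+ (K - #|I|)];
    a union bound over [I] gives [beta].

    The conditioning step needs the joint measurability of the instability set in
    the samples and in the new parameter, whereas [u] need not be measurable.
    Replace [u] by the tightened values [tight u uN S delta], the infimum of
    [x(S)] over the core of the single sample [delta]: cores and instability sets
    are unchanged. A combinatorial argument yields countably many samples such
    that the vector [(u S delta)_S] of any [delta] is approximated from above by
    joins of two of theirs; as cores vary in a Lipschitz way with their right-hand
    sides (Hoffman's bound), the sublevel sets of [tight u uN S] are countable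
    unions of complements of two-sample instability sets. *)
Require Import Defs.
From HB Require Import structures.
From mathcomp Require Import all_boot all_order all_algebra.
From mathcomp Require Import all_classical all_reals all_analysis.
From mathcomp Require Import ring lra.
Import Order.TTheory GRing.Theory Num.Theory.
Local Open Scope classical_set_scope.
Local Open Scope ring_scope.

(** * Hoffman's error bound *)

(** Supplies the value of the eliminated variable: the largest lower bound, with [- m] as default
    when there is none. *)
Lemma exists_between_bounds (R : realDomainType) (J : finType) (pl ph : pred J)
    (l h : J -> R) (m : R) :
  0 <= m ->
  (forall j, pl j -> l j <= m) -> (forall k, ph k -> - m <= h k) ->
  (forall j k, pl j -> ph k -> l j <= h k) ->
  exists t, [/\ `|t| <= m, forall j, pl j -> l j <= t
                & forall k, ph k -> t <= h k].
Proof.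
move=> m0 lm mh lh; exists (\big[Num.max/- m]_(j | pl j) l j); split.
- rewrite ler_norml; apply/andP; split; first exact: bigmax_ge_id.
  by apply/bigmax_leP; split => //; rewrite ge0_cp.
- by move=> j plj; exact: le_bigmax_cond.
- move=> k phk; apply/bigmax_leP; split => [|j plj]; first exact: mh.
  exact: lh.
Qed.

(* Hoffman's error bound for linear systems with fixed left-hand sides, by
   Fourier-Motzkin elimination of the last variable. *)
Lemma hoffman_bound (R : realFieldType) (n : nat) (J : finType)
    (a : J -> nat -> R) :
  exists2 C : R, 0 <= C & forall (c : J -> R) (e : R), 0 <= e ->
    (forall j, c j <= e) ->
    (exists d : nat -> R, forall j, c j <= \sum_(i < n) a j i * d i) ->
    exists d : nat -> R, (forall j, c j <= \sum_(i < n) a j i * d i) /\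
      (forall i, (i < n)%N -> `|d i| <= C * e).
Proof.
elim: n J a => [|n IHn] J a.
  exists 0 => // c e e0 ce [d hd]; exists (fun=> 0); split => // j.
  by move: (hd j); rewrite !big_ord0.
(* The eliminated system: rows free of variable [n] are kept, and each pair of rows with
   coefficients of opposite signs is normalised and subtracted; the remaining indices carry zero
   rows. *)
pose a' (x : J + J * J) i := match x with
  | inl j => if a j n == 0 then a j i else 0
  | inr (j, k) => if (0 < a j n) && (a k n < 0) then
      a j i / a j n - a k i / a k n else 0 end.
pose B := \sum_j `|a j n|^-1.
have B0 : 0 <= B by apply: sumr_ge0 => j _; rewrite invr_ge0.
have BE j : `|a j n|^-1 <= B.
  rewrite /B (bigD1 j) //= lerDl; apply: sumr_ge0 => k _; by rewrite invr_ge0.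
pose A := \sum_j \sum_(i < n) `|a j i|.
have AE j : \sum_(i < n) `|a j i| <= A.
  rewrite /A (bigD1 j) //= lerDl; apply: sumr_ge0 => k _; exact: sumr_ge0.
have A0 : 0 <= A by apply: sumr_ge0 => j _; apply: sumr_ge0.
have [C' C'0 HC'] := IHn _ a'.
(* Elimination inflates the bound [e] by at most [M]: a kept row costs 1, a difference of two
   normalised rows [2 * B]. *)
pose M := 1 + 2 * B.
have M0 : 0 <= M by rewrite /M; lra.
(* [C2 * e] bounds the last variable: [A * (C' * M) * e] bounds each row on the first [n] variables,
   and [B] the division by the coefficient. *)
pose C2 := B * (1 + A * (C' * M)).
have C20 : 0 <= C2 by rewrite /C2 mulr_ge0 // addr_ge0 // !mulr_ge0.
exists (C' * M + C2) => [|c e e0 ce [d0 hd0]].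
  by rewrite addr_ge0 // mulr_ge0.
pose c' (x : J + J * J) := match x with
  | inl j => if a j n == 0 then c j else 0
  | inr (j, k) => if (0 < a j n) && (a k n < 0) then
      c j / a j n - c k / a k n else 0 end.
have dotC (b : J -> nat -> R) j k x y (d : nat -> R) :
    \sum_(i < n) (b j i * x - b k i * y) * d i =
    (\sum_(i < n) b j i * d i) * x - (\sum_(i < n) b k i * d i) * y.
  rewrite !mulr_suml -sumrB; apply: eq_bigr => i _; ring.
have [|||d' [hd' nd']] := HC' c' (M * e).
- exact: mulr_ge0.
- have Me : e <= M * e by rewrite /M mulrDl mul1r lerDl !mulr_ge0.
  case=> [j|[j k]] /=; first by case: ifP => _; [exact: le_trans Me|exact: mulr_ge0].
  case: ifP => [/andP[aj ak]|_]; last exact: mulr_ge0.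
  have h1 : c j / a j n <= B * e.
    rewrite mulrC; apply: (@le_trans _ _ ((a j n)^-1 * e)).
      by rewrite ler_pM2l ?invr_gt0.
    by apply: ler_wpM2r => //; rewrite -[a j n]gtr0_norm.
  have h2 : - (c k / a k n) <= B * e.
    rewrite -mulrN -invrN mulrC; apply: (@le_trans _ _ ((- a k n)^-1 * e)).
      by rewrite ler_pM2l ?invr_gt0 ?oppr_gt0.
    by apply: ler_wpM2r => //; rewrite -ltr0_norm.
  rewrite /M; nra.
- exists d0; case=> [j|[j k]] /=.
    case: eqP => [aj|_]; last by rewrite big1 // => i _; rewrite mul0r.
    by move: (hd0 j); rewrite big_ord_recr /= aj mul0r addr0.
  case: ifP => [/andP[aj ak]|_]; last by rewrite big1 // => i _; rewrite mul0r.
  rewrite dotC; move: (hd0 j) (hd0 k); rewrite !big_ord_recr /=.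
  set x := \sum_(i < n) _; set y := \sum_(i < n) _ => h1 h2.
  have {}h1 : c j / a j n <= x / a j n + d0 n.
    rewrite ler_pdivrMr // mulrDl divfK ?gt_eqF //; lra.
  have {}h2 : y / a k n + d0 n <= c k / a k n.
    rewrite ler_ndivlMr // mulrDl divfK ?lt_eqF //; lra.
  lra.
pose s j := \sum_(i < n) a j i * d' i.
have sE j : `|s j| <= A * (C' * M) * e.
  apply: (le_trans (ler_norm_sum _ _ _)).
  apply: (@le_trans _ _ (\sum_(i < n) `|a j i| * (C' * (M * e)))).
    by apply: ler_sum => i _; rewrite normrM ler_wpM2l // nd'.
  rewrite -mulr_suml -!mulrA ler_wpM2r // !mulr_ge0 //.
have [|||t [tm tl th]] := @exists_between_bounds R J (fun j => 0 < a j n)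
   (fun k => a k n < 0) (fun j => (c j - s j) / a j n)
   (fun k => (c k - s k) / a k n) (C2 * e) (mulr_ge0 C20 e0).
- move=> j aj; rewrite mulrC /C2 -mulrA; apply: (@le_trans _ _ ((a j n)^-1 * ((1 + A * (C' * M)) * e))).
    rewrite ler_pM2l ?invr_gt0 // mulrDl mul1r lerD // (le_trans (ler_norm _)) //.
    by rewrite normrN.
  by apply: ler_wpM2r; [rewrite mulr_ge0 // addr_ge0 // !mulr_ge0|rewrite -[a j n]gtr0_norm].
- move=> j aj; rewrite lerNl -mulrN -invrN mulrC /C2 -mulrA.
  apply: (@le_trans _ _ ((- a j n)^-1 * ((1 + A * (C' * M)) * e))).
    rewrite ler_pM2l ?invr_gt0 ?oppr_gt0 // mulrDl mul1r lerD // (le_trans (ler_norm _)) //.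
    by rewrite normrN.
  by apply: ler_wpM2r; [rewrite mulr_ge0 // addr_ge0 // !mulr_ge0|rewrite -ltr0_norm].
- move=> j k aj ak; move: (hd' (inr (j, k))) => /=; rewrite aj ak /= dotC -/(s j) -/(s k).
  rewrite !mulrBl; lra.
pose d i := if i == n then t else d' i.
have dE j : \sum_(i < n.+1) a j i * d i = s j + a j n * t.
  rewrite big_ord_recr /= /d eqxx; congr (_ + _); apply: eq_bigr => i _.
  by rewrite ltn_eqF.
exists d; split => [j|i].
  rewrite dE; case: (ltrgtP (a j n) 0) => aj.
  - by have := th j aj; rewrite ler_ndivlMr // mulrC; lra.
  - by have := tl j aj; rewrite ler_pdivrMr // mulrC; lra.
  - by move: (hd' (inl j)) => /=; rewrite aj eqxx mul0r addr0.
move=> lein; rewrite /d mulrDl; case: eqP => [_|/eqP ni].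
  by rewrite (le_trans tm) // lerDr !mulr_ge0.
have ltin : (i < n)%N by rewrite ltn_neqAle ni -ltnS.
apply: (le_trans (nd' _ ltin)); rewrite mulrA lerDl. exact: mulr_ge0.
Qed.

(** * Covering by joins of two points *)

(** Induction on [#|A|]. Points strictly below a join are served by one pair chosen for each
    rational vector. The others have finitely many types, and each point of a given type shares a
    coordinate with a fixed representative, which leaves one coordinate fewer. *)
Lemma countable_join_cover_on (R : realType) (T : Type) (J : finType)
    (f : T -> J -> R) (A : {set J}) (X : set T) :
  exists X0 : set T, [/\ countable X0, X0 `<=` X &
    forall x, X x -> exists y z, [/\ X0 y, X0 z &
      forall j, j \in A -> f x j <= Num.max (f y j) (f z j)]].
Proof.
have [n] := ubnP #|A|; elim: n A X => // n IHn A X; rewrite ltnS => leAn.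
pose strict (q : J -> R) y z :=
  [/\ X y, X z & forall j, j \in A -> q j < Num.max (f y j) (f z j)].
have /choice[Xs HXs] (q : {ffun J -> rat}) : exists S : set T,
    [/\ countable S, S `<=` X & (exists y z, strict (ratr \o q) y z) ->
      exists y z, [/\ S y, S z & strict (ratr \o q) y z]].
  have [[y [z hyz]]|nyz] := pselect (exists y z, strict (ratr \o q) y z).
    exists [set y; z]; split.
    - by apply: finite_set_countable; exact: finite_set2.
    - by case: hyz => Xy Xz _ _ [->|->].
    - by move=> _; exists y, z; split => //; [left|right].
  by exists set0; split => //; exact: countable0.
pose Y := [set x | X x /\ ~ exists y z, strict (f x) y z].
(* Two points of [Y] of equal type share a coordinate in [A]; otherwise the
   direction from one to the other and the opposite direction both occur in
   their common type, and one of the points is strictly below a join. *)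
pose type x : {set {set J}} := [set s : {set J} | `[< exists y,
  [/\ Y y, forall j, j \in A -> f y j <> f x j
    & s = [set j in A | f x j < f y j]%SET] >]]%SET.
have typeP x0 x : Y x0 -> Y x -> type x = type x0 ->
    exists2 j, j \in A & f x j = f x0 j.
  move=> Yx0 Yx txx0; apply: contrapT => nshare.
  have nsh j : j \in A -> f x0 j <> f x j.
    by move=> jA /esym fj; apply: nshare; exists j.
  have : [set j in A | f x j < f x0 j]%SET \in type x.
    by rewrite inE; apply/asboolP; exists x0.
  rewrite txx0 inE => /asboolP[z [Yz _ sE]].
  case: (Yx0) => _; apply; exists x, z; split; [by case: Yx|by case: Yz|].
  move=> j jA; rewrite lt_max.
  case: (ltrgtP (f x0 j) (f x j)) => //= [lt|/nsh]; last by move/(_ jA).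
  have : j \in [set j in A | f x j < f x0 j]%SET by rewrite inE jA.
  by rewrite sE inE jA.
have /choice[Xt HXt] (t : {set {set J}}) : exists S : set T,
    [/\ countable S, S `<=` X & forall x, Y x -> type x = t ->
      exists y z, [/\ S y, S z &
        forall j, j \in A -> f x j <= Num.max (f y j) (f z j)]].
  have [[x0 [Yx0 tx0]]|nx0] := pselect (exists x0, Y x0 /\ type x0 = t); last first.
    exists set0; split; [exact: countable0|by []|].
    by move=> x Yx tx; exfalso; apply: nx0; exists x.
  have /choice[S HS] (j : J) : exists S : set T,
      [/\ countable S, S `<=` X & j \in A -> forall x, X x -> f x j = f x0 j ->
        exists y z, [/\ S y, S z &
          forall j, j \in A -> f x j <= Num.max (f y j) (f z j)]].
    have [jA|jA] := boolP (j \in A); last first.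
      by exists set0; split => //; exact: countable0.
    (* On the slice where coordinate [j] is constant, domination at [j] is automatic, so only
       [A :\ j] remains. *)
    have [|S [cS SX HS]] := IHn (A :\ j)%SET [set x | X x /\ f x j = f x0 j].
      by apply: leq_trans leAn; rewrite [X in (_ < X)%N](cardsD1 j) jA.
    exists S; split => // [x /SX []//|_ x Xx fxj].
    have [//|y [z [Sy Sz yz]]] := HS x.
    exists y, z; split => // k kA; have [->|kj] := eqVneq k j.
      by have [_ fyj] := SX _ Sy; rewrite fxj -fyj le_max lexx.
    by apply: yz; rewrite !inE kj.
  exists (\bigcup_j S j); split.
  - by apply: bigcup_countable => [|j _]; [exact: countableP|have [] := HS j].
  - by move=> x [j _]; have [_ + _] := HS j; apply.
  - move=> x Yx tx; have [|j jA fj] := typeP x0 x Yx0 Yx; first by rewrite tx tx0.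
    have [_ _ /(_ jA x _ fj)[|y [z [Sy Sz yz]]]] := HS j; first by case: Yx.
    by exists y, z; split => //; exists j.
exists (\bigcup_(b : bool) if b then \bigcup_q Xs q else \bigcup_t Xt t); split.
- apply: bigcup_countable => [|[] _]; first exact: countableP.
    apply: bigcup_countable => [|q _]; first exact: countableP.
    by have [] := HXs q.
  apply: bigcup_countable => [|t _]; first exact: countableP.
  by have [] := HXt t.
- by move=> x [[] _ [v _]]; [have [_ + _] := HXs v|have [_ + _] := HXt v]; apply.
- move=> x Xx; have [[y [z [Xy Xz yz]]]|nyz] := pselect (exists y z, strict (f x) y z).
    have /choice[q hq] (j : J) : exists q : rat, j \in A ->
        f x j < ratr q < Num.max (f y j) (f z j).
      have [jA|_] := boolP (j \in A); last by exists 0.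
      by have [q qin] := rat_in_itvoo (yz j jA); exists q; rewrite in_itv in qin.
    have [_ _ Hq] := HXs [ffun j => q j].
    have [|y' [z' [Sy' Sz' [_ _ yz']]]] := Hq.
      exists y, z; split => // j jA; rewrite /= ffunE.
      by have /andP[] := hq j jA.
    exists y', z'; split; try by exists true => //; exists [ffun j => q j].
    move=> j jA; apply: ltW; apply: lt_trans (yz' j jA).
    by rewrite /= ffunE; have /andP[] := hq j jA.
  have [_ _ /(_ x)[//|//|y [z [Sy Sz yz]]]] := HXt (type x).
  by exists y, z; split => //; exists false => //; exists (type x).
Qed.

(** Covering each cell of a grid of side [r] by its own points keeps the two dominating points
    within [r] of [x]; there are countably many cells since [J] is finite. *)
Lemma countable_join_cover (R : realType) (T : Type) (J : finType)
    (f : T -> J -> R) (r : R) : 0 < r ->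
  exists2 X0 : set T, countable X0 & forall x, exists y z, [/\ X0 y, X0 z &
    forall j, f x j <= Num.max (f y j) (f z j) <= f x j + r].
Proof.
move=> r0; pose cell (c : {ffun J -> int}) :=
  [set x | forall j, Num.floor (f x j / r) = c j].
have /choice[S HS] (c : {ffun J -> int}) :=
  @countable_join_cover_on R T J f [set: J]%SET (cell c).
exists (\bigcup_c S c).
  by apply: bigcup_countable => [|c _]; [exact: countableP|have [] := HS c].
move=> x; pose c := [ffun j => Num.floor (f x j / r)].
have [_ Sc /(_ x)[|y [z [Sy Sz yz]]]] := HS c; first by move=> j; rewrite ffunE.
exists y, z; split; [by exists c|by exists c|move=> j].
rewrite yz ?inE //=.
have near v : cell c v -> f v j <= f x j + r.
  move=> /(_ j); rewrite ffunE => vx.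
  have h1 : f v j / r < (Num.floor (f x j / r))%:~R + 1.
    by rewrite -vx -intrD1 floorD1_gt.
  have h2 : (Num.floor (f x j / r))%:~R <= f x j / r by exact: ge_floor.
  have : f v j / r < f x j / r + 1 by lra.
  by rewrite ltr_pdivrMr // mulrDl divfK ?gt_eqF // mul1r => /ltW.
by rewrite ge_max !near //; exact: Sc.
Qed.

(** * Product laws on tuples *)

Definition tuple_box {T : Type} {K : nat} (A : 'I_K -> set T) : set (K.-tuple T) :=
  [set w | forall i, A i (tnth w i)].

Definition tuple_merge {T : Type} {K : nat} (I : {set 'I_K})
    (p : K.-tuple T * K.-tuple T) : K.-tuple T :=
  [tuple if i \in I then tnth p.1 i else tnth p.2 i | i < K].

Lemma measurable_tuple_box (d : measure_display) (T : measurableType d)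
    (K : nat) (A : 'I_K -> set T) :
  (forall i, measurable (A i)) -> measurable (tuple_box A).
Proof.
move=> mA; rewrite (_ : tuple_box A =
    \bigcap_(i in [set: 'I_K]) ((fun w => tnth w i) @^-1` A i)).
  apply: fin_bigcap_measurable => [|i _]; first exact: finite_finset.
  by rewrite -[X in measurable X]setTI; exact: measurable_tnth.
by apply/seteqP; split => [w Aw i _|w Aw i]; [exact: Aw|exact: (Aw i I)].
Qed.

(** Cylinders over one coordinate are not stable under intersection; boxes are, and the product law
    is prescribed on them. *)
Lemma measurable_tupleE (d : measure_display) (T : measurableType d) (K : nat) :
  @measurable _ (K.-tuple T) =
  <<s [set tuple_box A | A in [set A : 'I_K -> set T | forall i, measurable (A i)]] >>.
Proof.
apply/seteqP; split.
- apply: smallest_sub; first exact: smallest_sigma_algebra.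
  move=> B; rewrite -bigcup_seq/= => -[i _ [Y mY <-]].
  apply: sub_sigma_algebra; exists (fun j => if j == i then Y else setT).
    by move=> j /=; case: ifP.
  apply/seteqP; split => [w /(_ i)|w [_ Yw] j]; first by rewrite eqxx.
  by case: eqP => // ->.
- apply: smallest_sub; first exact: sigma_algebra_measurable.
  by move=> _ [A mA <-]; exact: measurable_tuple_box.
Qed.

Lemma measurable_tuple_merge (d : measure_display) (T : measurableType d)
    (K : nat) (I : {set 'I_K}) :
  measurable_fun setT (@tuple_merge T K I).
Proof.
apply/measurable_fun_tnthP => i.
rewrite (_ : _ \o _ = if i \in I then (fun w => tnth w i) \o fst
                      else (fun w => tnth w i) \o snd).
  by case: ifP => _; apply: measurableT_comp => //; exact: measurable_tnth.
by apply/funext => p; rewrite /= tnth_mktuple; case: ifP.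
Qed.

Section product_law.
Context (R : realType) (d : measure_display) (T : measurableType d).
Context (P : probability T R) (K : nat) (PK : probability (K.-tuple T) R).
Hypothesis hPK : forall A : 'I_K -> set T, (forall i, measurable (A i)) ->
  PK (tuple_box A) = (\prod_(i < K) P (A i))%E.

(** Both laws agree on boxes, whose constraints split between the two independent copies. Redrawing
    the coordinates outside [I] turns conditioning on those in [I] into an iterated integral. *)
Lemma tuple_merge_law (I : {set 'I_K}) (A : set (K.-tuple T)) : measurable A ->
  PK A = (PK \x PK)%E (tuple_merge I @^-1` A).
Proof.
move=> mA; rewrite -/(pushforward (PK \x PK)%E (tuple_merge I) A).
pose m2 : {measure set (K.-tuple T) -> \bar R} :=
  measure_function_pushforward__canonical__measure_function_Measure
   (PK \x PK)%E (@measurable_tuple_merge _ _ _ I).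
rewrite -[RHS]/(m2 A).
apply: (measure_unique _ (fun=> setT) (@measurable_tupleE _ T K)) => //.
- move=> _ _ [A1 mA1 <-] [A2 mA2 <-]; exists (fun i => A1 i `&` A2 i).
    by move=> i; exact: measurableI.
  by apply/seteqP; split => [w h|w [h1 h2] i]; [split=> i; have [] := h i|split].
- by move=> _; exists (fun=> setT) => //; apply/seteqP; split.
- by apply/seteqP; split => // w _; exists 0%N.
- move=> _ [B mB <-].
  pose B1 i := if i \in I then B i else setT.
  pose B2 i := if i \in I then setT else B i.
  have mB1 i : measurable (B1 i) by rewrite /B1; case: ifP.
  have mB2 i : measurable (B2 i) by rewrite /B2; case: ifP.
  rewrite /m2 /= /pushforward (_ : _ @^-1` _ = tuple_box B1 `*` tuple_box B2).
    rewrite product_measure1E; [|exact: measurable_tuple_box..].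
    rewrite -[RHS]/(PK (tuple_box B1) * PK (tuple_box B2))%E !hPK // -big_split; apply: eq_bigr => i _.
    by rewrite /= /B1 /B2; case: ifP => _; rewrite probability_setT ?mule1 ?mul1e.
  apply/seteqP; split => [[w w'] h|[w w'] [h1 h2] i] /=.
    by split=> i; move: (h i); rewrite tnth_mktuple /B1 /B2; case: ifP.
  by move: (h1 i) (h2 i); rewrite tnth_mktuple /B1 /B2; case: ifP.
- by move=> _; rewrite (le_lt_trans (probability_le1 PK measurableT)) ?ltry.
Qed.

Lemma compression_bound (I : {set 'I_K}) (V : K.-tuple T -> set T) (e : R) :
  (forall w w', (forall i, i \in I -> tnth w i = tnth w' i) -> V w = V w') ->
  (forall w, measurable (V w)) ->
  (forall j, j \notin I -> measurable [set w | V w (tnth w j)]) ->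
  0 <= e <= 1 ->
  exists F : set (K.-tuple T),
    [/\ measurable F, (PK F <= ((1 - e) ^+ (K - #|I|))%:E)%E &
        forall w, (e%:E < P (V w))%E ->
          (forall j, j \notin I -> ~ V w (tnth w j)) -> F w].
Proof.
move=> VI mV mB /andP[e0 e1].
pose E := [set w | forall j, j \notin I -> ~ V w (tnth w j)].
have mE : measurable E.
  rewrite (_ : E = \bigcap_(j in [set j | j \notin I]) ~` [set w | V w (tnth w j)]).
    apply: fin_bigcap_measurable => [|j jI]; first exact: finite_finset.
    by apply: measurableC; exact: mB.
  by apply/seteqP; split.
have Vmerge w w' : V (tuple_merge I (w, w')) = V w.
  by apply: VI => i iI; rewrite tnth_mktuple iI.
have mmerge (A : set (K.-tuple T)) : measurable A ->
      measurable (tuple_merge I @^-1` A).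
  move=> mA; rewrite -[X in measurable X]setTI.
  exact: (@measurable_tuple_merge _ _ _ I measurableT A mA).
(* [h w] is the conditional probability of [E] given the coordinates of [w] in [I]. *)
pose h := PK \o xsection (tuple_merge I @^-1` E).
have mh := measurable_fun_xsection PK (mmerge E mE).
pose c := (1 - e) ^+ (K - #|I|).
have c0 : 0 <= c by rewrite exprn_ge0 // subr_ge0.
have hE w : h w = ((1 - fine (P (V w))) ^+ (K - #|I|))%:E.
  pose B j := if j \in I then setT else ~` V w.
  rewrite /h /= (_ : xsection _ _ = tuple_box B); last first.
    apply/seteqP; split => [w'|w' hw'].
      rewrite /xsection /= inE => hw' j; rewrite /B; case: ifP => // /negbT jI.
      by have := hw' j jI; rewrite Vmerge tnth_mktuple (negbTE jI).
    rewrite /xsection /= inE => j jI; rewrite Vmerge tnth_mktuple (negbTE jI).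
    by have := hw' j; rewrite /B (negbTE jI).
  rewrite hPK; last by move=> j; rewrite /B; case: ifP => // _; exact: measurableC.
  pose b := 1 - fine (P (V w)).
  rewrite (eq_bigr (fun j => (if j \in I then 1 else b)%:E)); last first.
    move=> j _; rewrite /B; case: ifP => _; first by rewrite probability_setT.
    by rewrite probability_setC // -[P (V w)]fineK ?fin_num_measure.
  rewrite prodEFin -/b; congr EFin.
  rewrite (bigID (mem I)) /= big1 ?mul1r; last by move=> i ->.
  rewrite (eq_bigr (fun=> b)); last by move=> i /negbTE ->.
  rewrite prodr_const; congr (_ ^+ _).
  have <- : #|~: I| = (K - #|I|)%N.
    by apply/eqP; rewrite -(eqn_add2l #|I|) cardsC card_ord subnKC // -[X in (_ <= X)%N]card_ord max_card.
  by apply: eq_card => i; rewrite !inE.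
(* The condition [h w <= c] follows from [e < P (V w)] and is measurable because [h] is a section
   probability. *)
have mF : measurable (E `&` [set w | (h w <= c%:E)%E]).
  apply: measurableI => //; rewrite -[X in measurable X]setTI.
  exact: measurable_realfun.emeasurable_fun_infty_c mh _.
exists (E `&` [set w | (h w <= c%:E)%E]); split => //; last first.
  move=> w eV Vw; split => //=.
  have fV : P (V w) \is a fin_num by rewrite fin_num_measure.
  have V1 : (P (V w) <= 1)%E by exact: probability_le1.
  rewrite hE lee_fin lerXn2r ?nnegrE ?subr_ge0 //.
    by rewrite -lee_fin fineK.
  by rewrite lerB // ltW // -lte_fin fineK.
rewrite (tuple_merge_law I) // /product_measure1 -[leRHS]mule1.
rewrite -(@probability_setT _ _ _ PK) -integral_cst //.
apply: ge0_le_integral => //.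
- by apply: measurable_fun_xsection; exact: mmerge.
- move=> w _ /=; have [hw|hw] := boolP (h w <= c%:E)%E.
    apply: le_trans hw; apply: le_measure; rewrite ?inE;
      try by apply: measurable_xsection; exact: mmerge.
    by move=> w'; rewrite /xsection /= !inE => -[].
  (* A section over [w] with [c < h w] is empty, because [h] takes the same value at the merged
     tuple. *)
  rewrite (_ : xsection _ _ = set0) ?measure0 ?lee_fin //.
  apply/seteqP; split => // w'; rewrite /xsection /= inE => -[_] /=.
  by rewrite hE Vmerge -hE (negbTE hw).
Qed.

End product_law.

(** * Measurability of instability events *)

Lemma countable_bigcup_measurable (d : measure_display) (T : measurableType d)
    (U : Type) (D : set U) (F : U -> set T) : countable D ->
  (forall i, D i -> measurable (F i)) -> measurable (\bigcup_(i in D) F i).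
Proof.
move=> /countable_injP[f injf] mF.
rewrite (_ : \bigcup_(i in D) F i =
    \bigcup_n \bigcup_(i in [set i | D i /\ f i = n]) F i); last first.
  apply/seteqP; split => [x [i Di Fix]|x [n _ [i [Di _] Fix]]].
    by exists (f i) => //; exists i.
  by exists i.
apply: bigcupT_measurable => n.
have [[i0 [Di0 fi0]]|ni] := pselect (exists i, D i /\ f i = n).
  rewrite (_ : \bigcup_(i in _) F i = F i0); first exact: mF.
  apply/seteqP; split => [x [i [Di fi] Fix]|x Fx]; last by exists i0.
  by rewrite -(injf i i0) ?inE // fi.
rewrite (_ : \bigcup_(i in _) F i = set0) //.
by apply/seteqP; split => // x [i Di _]; exfalso; apply: ni; exists i.
Qed.

(** Hoffman's bound for the displacement [x - p], the efficiency equation being split into two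
    opposite rows. The constant depends on the coalitions only, so it serves all [b] and [uN]. *)
Lemma core_error_bound (R : realFieldType) (N : nat) (J : finType)
    (s : J -> {set 'I_N}) :
  exists2 C : R, 0 <= C & forall (uN : R) (b : J -> R),
    (exists x : 'I_N -> R, \sum_(i < N) x i = uN /\
       forall j, b j <= \sum_(i in s j) x i) ->
    forall (p : 'I_N -> R) (e : R), 0 <= e ->
      `|\sum_(i < N) p i - uN| <= e ->
      (forall j, b j <= \sum_(i in s j) p i + e) ->
      exists x : 'I_N -> R, [/\ \sum_(i < N) x i = uN,
        forall j, b j <= \sum_(i in s j) x i & forall i, `|x i - p i| <= C * e].
Proof.
pose a (x : J + bool) (i : nat) : R := match x with
  | inl j => if (insub i : option 'I_N) is Some k then (k \in s j)%:R else 0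
  | inr true => 1
  | inr false => -1 end.
have aj j (d : 'I_N -> R) : \sum_(i < N) a (inl j) i * d i = \sum_(i in s j) d i.
  rewrite [RHS]big_mkcond; apply: eq_bigr => i _; rewrite /a valK.
  by case: (i \in s j); rewrite ?mul1r ?mul0r.
have at_ (d : 'I_N -> R) : \sum_(i < N) a (inr true) i * d i = \sum_(i < N) d i.
  by apply: eq_bigr => i _; rewrite mul1r.
have af (d : 'I_N -> R) : \sum_(i < N) a (inr false) i * d i = - \sum_(i < N) d i.
  by rewrite -sumrN; apply: eq_bigr => i _; rewrite mulN1r.
have [C C0 HC] := hoffman_bound R N _ a.
exists C => // uN b [x [xN xb]] p e e0; rewrite ler_norml => /andP[pN1 pN2] pb.
pose c (y : J + bool) := match y with
  | inl j => b j - \sum_(i in s j) p i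
  | inr true => uN - \sum_(i < N) p i
  | inr false => \sum_(i < N) p i - uN end.
have [| |d [hd nd]] := HC c e e0.
- by case=> [j|[]] /=; [have := pb j|..]; lra.
- exists (fun i => if (insub i : option 'I_N) is Some k then x k - p k else 0).
  case=> [j|[]].
  + rewrite aj (eq_bigr (fun i => x i - p i)) /=; last by move=> i _; rewrite valK.
    by rewrite sumrB; have := xb j; lra.
  + rewrite at_ (eq_bigr (fun i => x i - p i)) /=; last by move=> i _; rewrite valK.
    by rewrite sumrB xN; lra.
  + rewrite af (eq_bigr (fun i => x i - p i)) /=; last by move=> i _; rewrite valK.
    by rewrite sumrB xN; lra.
exists (fun i => p i + d i); split.
- have := hd (inr true); have := hd (inr false); rewrite at_ af /= big_split /=; lra.
- by move=> j; have := hd (inl j); rewrite aj /= big_split /=; lra.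
- by move=> i; rewrite addrAC subrr add0r; exact: nd.
Qed.

Lemma algP (R : realType) (N : nat) (Delta : Type)
    (u : {set 'I_N} -> Delta -> R) (uN : R) (K : nat) (w : K.-tuple Delta)
    (I : {set 'I_K}) (x : 'I_N -> R) :
  alg u uN w I x <-> \sum_(i < N) x i = uN /\
    forall S k, S != [set: 'I_N]%SET -> k \in I ->
      u S (tnth w k) <= \sum_(i in S) x i.
Proof.
split=> [[xN xu]|[xN xu]]; split => //.
  by move=> S k ST kI; apply: xu => //; exists k.
by move=> S ST _ [k kI ->]; exact: xu.
Qed.

(** Rows indexed by a sample position in [I] and a proper coalition do not involve [w] or [u], hence
    one constant for all multi-samples and games. *)
Lemma alg_error_bound (R : realType) (N K : nat) (I : {set 'I_K}) :
  exists2 C : R, 0 <= C & forall (Delta : Type)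
    (u : {set 'I_N} -> Delta -> R) (uN : R) (w : K.-tuple Delta),
    alg u uN w I !=set0 ->
    forall (p : 'I_N -> R) (e : R), 0 <= e ->
      `|\sum_(i < N) p i - uN| <= e ->
      (forall S k, S != [set: 'I_N]%SET -> k \in I ->
        u S (tnth w k) <= \sum_(i in S) p i + e) ->
      exists2 x, alg u uN w I x &
        forall S : {set 'I_N}, \sum_(i in S) x i <= \sum_(i in S) p i + C * e.
Proof.
pose J := {y : 'I_K * {set 'I_N} | (y.1 \in I) && (y.2 != [set: 'I_N]%SET)}.
have [C C0 HC] := @core_error_bound R N J (fun j => (val j).2).
exists (N%:R * C) => [|Delta u uN w [x0 /algP[x0N x0u]] p e e0 pN pu].
  by rewrite mulr_ge0.
have [||x [xN xu xp]] := HC uN (fun j => u (val j).2 (tnth w (val j).1)) _ p e e0 pN.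
- exists x0; split => // -[[k S] /= /andP[kI ST]]; exact: x0u.
- by case=> [[k S] /= /andP[kI ST]]; exact: pu.
exists x.
  apply/algP; split => // S k ST kI.
  have kS : ((k, S).1 \in I) && ((k, S).2 != [set: 'I_N]%SET) by rewrite kI.
  exact: (xu (exist _ (k, S) kS)).
move=> S; rewrite -lerBlDl -sumrB.
apply: (@le_trans _ _ (\sum_(i < N) C * e)); last by rewrite sumr_const card_ord -[(C * e) *+ _]mulr_natl mulrA.
rewrite big_mkcond; apply: ler_sum => i _; case: ifP => _; last exact: mulr_ge0.
exact: le_trans (ler_norm _) (xp i).
Qed.

(** A rational threshold between [x(S)] and [u S delta] replaces the union over the arbitrary set
    [C] by a countable one. *)
Lemma measurable_instability_set (R : realType) (d : measure_display)
    (Delta : measurableType d) (N : nat) (u : {set 'I_N} -> Delta -> R)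
    (C : set ('I_N -> R)) :
  (forall S, S != [set: 'I_N]%SET -> measurable_fun setT (u S)) ->
  measurable (instability_set u C).
Proof.
move=> mu.
rewrite (_ : instability_set u C = \bigcup_(S in [set S | S != [set: 'I_N]%SET])
  \bigcup_(q in [set q : rat | exists2 x, C x & \sum_(i in S) x i < ratr q])
    (u S @^-1` `]ratr q, +oo[)).
  apply: fin_bigcup_measurable => [|S ST]; first exact: finite_finset.
  apply: countable_bigcup_measurable => [|q _]; first exact: countableP.
  by rewrite -[X in measurable X]setTI; apply: mu.
apply/seteqP; split => [delta [x [Cx [S [ST xS]]]]|].
  exists S => //; have [q] := rat_in_itvoo xS; rewrite in_itv /= => /andP[xq qu].
  by exists q; [exists x|rewrite /= in_itv /= qu].
move=> delta [S ST [q [x Cx xq]]]; rewrite /= in_itv /= andbT => qu.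
by exists x; split => //; exists S; split => //; exact: lt_trans qu.
Qed.

Lemma measurable_sample_instability (R : realType) (d : measure_display)
    (Delta : measurableType d) (N : nat) (u : {set 'I_N} -> Delta -> R) (uN : R)
    (K : nat) (I : {set 'I_K}) (j : 'I_K) :
  (forall S, S != [set: 'I_N]%SET -> measurable_fun setT (u S)) ->
  (forall w : K.-tuple Delta, alg u uN w I !=set0) ->
  measurable [set w : K.-tuple Delta |
    instability_set u (alg u uN w I) (tnth w j)].
Proof.
move=> mu hne; have [C C0 HC] := alg_error_bound R N K I.
pose ev (q : {ffun 'I_N -> rat}) (S : {set 'I_N}) : R := \sum_(i in S) ratr (q i).
pose e n : R := n.+1%:R^-1.
have e0 n : 0 < e n by rewrite invr_gt0.
have C1 : 0 < C + 1 by lra.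
(* The core is nonempty but may have no rational point, so its points are
   replaced by rational [e n]-approximate ones, at the cost [C * e n]. *)
pose B (S : {set 'I_N}) (n : nat) (q : {ffun 'I_N -> rat}) :=
  \bigcap_(x in [set x : 'I_K * {set 'I_N} | (x.1 \in I) && (x.2 != [set: 'I_N]%SET)])
    [set w : K.-tuple Delta | u x.2 (tnth w x.1) <= ev q x.2 + e n]
  `&` [set w | ev q S + C * e n < u S (tnth w j)].
have mfun S k : S != [set: 'I_N]%SET ->
    measurable_fun setT (fun w : K.-tuple Delta => u S (tnth w k)).
  by move=> ST; apply: measurableT_comp; [exact: mu|exact: measurable_tnth].
rewrite (_ : [set w | _] = \bigcup_(S in [set S | S != [set: 'I_N]%SET]) \bigcup_n
    \bigcup_(q in [set q : {ffun 'I_N -> rat} | `|\sum_(i < N) ratr (q i) - uN| <= e n]) B S n q).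
  apply: fin_bigcup_measurable => [|S ST]; first exact: finite_finset.
  apply: bigcupT_measurable => n.
  apply: countable_bigcup_measurable => [|q _]; first exact: countableP.
  apply: measurableI.
    apply: fin_bigcap_measurable => [|[k S'] /= /andP[_ S'T]]; first exact: finite_finset.
    rewrite (_ : [set w | _] = setT `&` (fun w => u S' (tnth w k)) @^-1` `]-oo, ev q S' + e n]).
      by apply: mfun.
    by rewrite setTI; apply/seteqP; split => w; rewrite /= in_itv.
  rewrite (_ : [set w | _] = setT `&` (fun w => u S (tnth w j)) @^-1` `]ev q S + C * e n, +oo[).
    by apply: mfun.
  by rewrite setTI; apply/seteqP; split => w; rewrite /= in_itv /= andbT.
apply/seteqP; split => [w [x [/algP[xN xu] [S [ST xS]]]]|w [S ST [n _ [q qN [qI qS]]]]].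
- exists S => //.
  (* The gap must absorb [e n] for the rational rounding and [C * e n] for the margin in [B]. *)
  have [n] : exists n, e n < (u S (tnth w j) - \sum_(i in S) x i) / (C + 1).
    have [|n] := @ltr_add_invr R 0 ((u S (tnth w j) - \sum_(i in S) x i) / (C + 1)).
      by rewrite divr_gt0 ?subr_gt0.
    by rewrite add0r; exists n.
  rewrite ltr_pdivlMr // => en; exists n => //.
  have N0 : 0 < N.+1%:R :> R by [].
  (* With a share [e n / N.+1%:R] per coordinate, every coalition sum rises by at most [e n]. *)
  have /choice[q hq] (i : 'I_N) : exists q : rat, x i < ratr q < x i + e n / N.+1%:R.
    have [|q] := @rat_in_itvoo R (x i) (x i + e n / N.+1%:R).
      by rewrite ltrDl divr_gt0.
    by rewrite in_itv; exists q.
  pose qf := [ffun i => q i].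
  have near (S' : {set 'I_N}) : \sum_(i in S') x i <= ev qf S' <= \sum_(i in S') x i + e n.
    apply/andP; split.
      by apply: ler_sum => i _; rewrite ffunE; have /andP[/ltW] := hq i.
    rewrite -lerBlDl -sumrB.
    apply: (@le_trans _ _ (\sum_(i < N) (e n / N.+1%:R))).
      rewrite big_mkcond; apply: ler_sum => i _; case: ifP => _; last by rewrite divr_ge0 // ltW.
      by rewrite ffunE lerBlDl; have /andP[_ /ltW] := hq i.
    rewrite sumr_const card_ord -[(_ / _) *+ _]mulr_natl mulrCA ler_piMr ?ltW // ltr_pdivrMr //.
    by rewrite mul1r ltr_nat.
  exists qf.
    rewrite /= -xN ler_norml.
    have := near [set: 'I_N]%SET; rewrite /ev.
    have sT (F : 'I_N -> R) : \sum_(i in [set: 'I_N]%SET) F i = \sum_(i < N) F i.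
      by apply: eq_bigl => i; rewrite inE.
    by rewrite !sT; have := e0 n; lra.
  split.
    move=> [k S'] /= /andP[kI S'T]; apply: (le_trans (xu S' k S'T kI)).
    by have /andP[] := near S'; have := e0 n; lra.
  by rewrite /=; have /andP[_] := near S; lra.
(* Conversely, the rational point is moved into the core, and the margin [C * e n] pays for the
   move. *)
- have [||x xI xS] := HC Delta u uN w (hne w) (fun i => ratr (q i)) (e n) (ltW (e0 n)).
  + exact: qN.
  + by move=> S' k S'T kI; apply: (qI (k, S')); rewrite /= kI.
  exists x; split => //; exists S; split => //.
  exact: le_lt_trans (xS S) qS.
Qed.

(** * Elementary properties of scenario cores *)

Lemma alg_subset (R : realType) (N : nat) (Delta : Type)
    (u : {set 'I_N} -> Delta -> R) (uN : R) (K : nat) (w : K.-tuple Delta)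
    (I : {set 'I_K}) : alg u uN w [set: 'I_K]%SET `<=` alg u uN w I.
Proof.
by move=> x /algP[xN xu]; apply/algP; split => // S k ST _; exact: xu.
Qed.

Lemma eq_alg (R : realType) (N : nat) (Delta : Type)
    (u : {set 'I_N} -> Delta -> R) (uN : R) (K : nat) (w w' : K.-tuple Delta)
    (I : {set 'I_K}) :
  (forall i, i \in I -> tnth w i = tnth w' i) -> alg u uN w I = alg u uN w' I.
Proof.
move=> ww'; apply/seteqP; split => x /algP[xN xu]; apply/algP; split => // S k ST kI.
  by rewrite -ww' //; exact: xu.
by rewrite ww' //; exact: xu.
Qed.

Lemma sample_stable (R : realType) (N : nat) (Delta : Type)
    (u : {set 'I_N} -> Delta -> R) (uN : R) (K : nat) (w : K.-tuple Delta)
    (j : 'I_K) :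
  ~ instability_set u (alg u uN w [set: 'I_K]%SET) (tnth w j).
Proof.
move=> [x [/algP[_ xu] [S [ST]]]]; apply/negP; rewrite -leNgt.
by apply: xu => //; rewrite inE.
Qed.

(** * The tightened game *)

(* The guaranteed amount of a coalition over the core of a single sample. It
   defines the same scenario cores as [u], and is measurable even if [u] is not. *)
Definition tight {R : realType} {N : nat} {Delta : Type}
    (u : {set 'I_N} -> Delta -> R) (uN : R) (S : {set 'I_N}) (delta : Delta) : R :=
  inf [set \sum_(i in S) p i | p in scenario_core u uN [set delta]].

Section tight.
Context (R : realType) (N : nat) (Delta : Type).
Context (u : {set 'I_N} -> Delta -> R) (uN : R).
Hypothesis hne : forall delta, scenario_core u uN [set delta] !=set0.

Lemma le_tight S delta : S != [set: 'I_N]%SET -> u S delta <= tight u uN S delta.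
Proof.
move=> ST; apply: lb_le_inf.
  by have [p hp] := hne delta; exists (\sum_(i in S) p i), p.
by move=> _ [p [_ pu] <-]; exact: pu.
Qed.

Lemma tight_le S delta p : S != [set: 'I_N]%SET ->
  scenario_core u uN [set delta] p -> tight u uN S delta <= \sum_(i in S) p i.
Proof.
move=> ST hp; apply: ge_inf; last by exists p.
by exists (u S delta) => _ [q [_ qu] <-]; exact: qu.
Qed.

Lemma tight_ltP S delta r : S != [set: 'I_N]%SET ->
  tight u uN S delta < r <->
  exists2 p, scenario_core u uN [set delta] p & \sum_(i in S) p i < r.
Proof.
move=> ST; split => [|[p hp]]; last by apply: le_lt_trans; exact: tight_le.
move=> /inf_lt[|_ [p hp <-] pr]; last by exists p.
by have [p hp] := hne delta; exists (\sum_(i in S) p i), p.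
Qed.

Lemma scenario_core_tight D :
  scenario_core (tight u uN) uN D = scenario_core u uN D.
Proof.
apply/seteqP; split => x [xN xu]; split => // S ST delta Ddelta.
  by apply: le_trans (xu S ST delta Ddelta); exact: le_tight.
by apply: tight_le => //; split => // S' S'T _ ->; exact: xu.
Qed.

(** An efficient allocation without objection at [delta] in the game [u] lies in the core of
    [delta], hence meets the tightened values too. The objecting coalition may differ between the
    two games. *)
Lemma instability_set_tight D :
  instability_set (tight u uN) (scenario_core u uN D) =
  instability_set u (scenario_core u uN D).
Proof.
apply/seteqP; split => delta [x [Cx [S [ST xS]]]]; exists x; split => //.
  apply: contrapT => nS; move: xS; apply/negP; rewrite -leNgt; apply: tight_le => //.
  case: Cx => xN _; split => // S' S'T _ ->; rewrite leNgt; apply/negP => xS'.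
  by apply: nS; exists S'.
by exists S; split => //; apply: lt_le_trans xS _; exact: le_tight.
Qed.

End tight.

Lemma measurable_tight (R : realType) (d : measure_display)
    (Delta : measurableType d) (N : nat) (u : {set 'I_N} -> Delta -> R) (uN : R)
    (K : nat) (S : {set 'I_N}) : (1 < K)%N ->
  (forall delta, scenario_core u uN [set delta] !=set0) ->
  (forall w : K.-tuple Delta, alg u uN w [set: 'I_K]%SET !=set0) ->
  (forall w : K.-tuple Delta,
     measurable (instability_set u (alg u uN w [set: 'I_K]%SET))) ->
  S != [set: 'I_N]%SET -> measurable_fun setT (tight u uN S).
Proof.
move=> K1 hne1 hne hmV ST.
apply: (measurability _ (measurable_realfun.RGenInftyO.measurableE R)) => //.
move=> _ [_ [r ->] <-]; rewrite setTI.
pose e n : R := n.+1%:R^-1.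
have e0 n : 0 < e n by rewrite invr_gt0.
have /choice[X0 HX0] n : exists X0 : set Delta, countable X0 /\ forall x,
    exists y z, [/\ X0 y, X0 z & forall S,
      u S x <= Num.max (u S y) (u S z) <= u S x + e n].
  have [X0 cX0 HX0] := countable_join_cover R Delta _ (fun x S => u S x) _ (e0 n).
  by exists X0.
(* As [1 < K], both points of the pair occur, so the constraints of this multi-sample are those of
   their join. *)
pose w (p : Delta * Delta) := [tuple if i == 0%N :> nat then p.1 else p.2 | i < K].
have K0 : (0 < K)%N by exact: ltnW.
rewrite (_ : tight u uN S @^-1` `]-oo, r[ = \bigcup_n
  \bigcup_(p in [set p | (X0 n `*` X0 n) p /\
             exists2 x, alg u uN (w p) [set: 'I_K]%SET x & \sum_(i in S) x i < r])
    ~` instability_set u (alg u uN (w p) [set: 'I_K]%SET)).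
  apply: bigcupT_measurable => n; apply: countable_bigcup_measurable => [|p _].
    apply: (@sub_countable _ _ _ (X0 n `*` X0 n)).
      by apply: subset_card_le => p [].
    by apply: countableX; have [] := HX0 n.
  by apply: measurableC; exact: hmV.
apply/seteqP; split => [delta|delta [n _ [p [_ [x xw xr]] ndelta]]]; last first.
  (* When [delta] is outside the instability set, every core point of [w p] lies in the core of
     [delta]; thus [x] witnesses the strict inequality. *)
  rewrite /= in_itv /=; apply/(tight_ltP R N Delta u uN hne1) => //; exists x => //.
  have [xN _] := xw; split => // S' S'T _ ->; rewrite leNgt; apply/negP => xS'.
  by apply: ndelta; exists x; split => //; exists S'.
rewrite /= in_itv /= => /(tight_ltP R N Delta u uN hne1 _ _ _ ST)[p [pN pu] pr].
have [C C0 HC] := alg_error_bound R N K [set: 'I_K]%SET.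
have C1 : 0 < C + 1 by lra.
(* [p] violates the constraints of the join by at most [e n], and moving it into that core costs
   [C * e n] at [S]; dividing by [C + 1] avoids a zero divisor. *)
have [n en] : exists n, e n < (r - \sum_(i in S) p i) / (C + 1).
  have [|n] := @ltr_add_invr R 0 ((r - \sum_(i in S) p i) / (C + 1)).
    by rewrite divr_gt0 ?subr_gt0.
  by rewrite add0r; exists n.
rewrite ltr_pdivlMr // in en; exists n => //.
have [_ /(_ delta)[y [z [Xy Xz yz]]]] := HX0 n.
have [||x xw xp] := HC Delta u uN (w (y, z)) (hne _) p (e n) (ltW (e0 n)).
- by rewrite pN subrr normr0 ltW.
- move=> S' k S'T _; have /andP[_ ub] := yz S'.
  apply: (@le_trans _ _ (Num.max (u S' y) (u S' z))).
    by rewrite tnth_mktuple le_max; case: ifP => _; rewrite lexx ?orbT.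
  by apply: (le_trans ub); rewrite lerD2r; exact: pu.
exists (y, z).
  split => //; exists x => //; apply: le_lt_trans (xp S) _.
  by have := e0 n; nra.
move=> [x' [/algP[_ x'u] [S' [S'T]]]]; apply/negP; rewrite -leNgt.
have /andP[ub _] := yz S'; apply: (le_trans ub); rewrite ge_max.
have := x'u S' (Ordinal K0) S'T; have := x'u S' (Ordinal K1) S'T.
by rewrite !tnth_mktuple !inE /= => -> // ->.
Qed.

(** * Union bound over compression sets *)

(** The first alternative is the default [K] of the iterated minimum; it causes no loss later
    because [eps K = 1]. *)
Lemma min_compression_sizeP (R : realType) (N : nat) (Delta : Type)
    (u : {set 'I_N} -> Delta -> R) (uN : R) (K : nat) (w : K.-tuple Delta) :
  min_compression_size u uN w = K \/
  exists2 I : {set 'I_K}, alg u uN w I = alg u uN w [set: 'I_K]%SET &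
    #|I| = min_compression_size u uN w.
Proof.
apply: (big_rec (fun s => s = K \/ exists2 I : {set 'I_K},
  alg u uN w I = alg u uN w [set: 'I_K]%SET & #|I| = s)) => [|I s /asboolP hI [->|[I' hI' <-]]].
- by left.
- by case: leqP => _; [right; exists I|left].
- by case: leqP => _; right; [exists I|exists I'].
Qed.

Lemma sum_subsets_by_card (R : pzRingType) (K : nat) (F : nat -> R) :
  \sum_(I : {set 'I_K} | (#|I| < K)%N) F #|I| = \sum_(s < K) 'C(K, s)%:R * F s.
Proof.
transitivity (\sum_(s < K) \sum_(I : {set 'I_K} | #|I| == s) F s); last first.
  apply: eq_bigr => s _; rewrite sumr_const mulr_natl; congr (_ *+ _).
  have := card_draws 'I_K s; rewrite card_ord => <-.
  by apply: eq_card => I; rewrite !inE.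
rewrite (exchange_big_dep (fun I : {set 'I_K} => (#|I| < K)%N)) /=; last first.
  by move=> s I _ /eqP ->.
by apply: eq_bigr => I IK; rewrite (big_pred1 (Ordinal IK)).
Qed.

(** The event attached to a single [I] is only enclosed in a measurable set [F], which is enough for
    subadditivity. *)
Lemma compression_union_bound (R : realType) (d : measure_display)
    (Delta : measurableType d) (P : probability Delta R) (N : nat)
    (u : {set 'I_N} -> Delta -> R) (uN : R) (K : nat)
    (PK : probability (K.-tuple Delta) R) (beta : R) (eps : nat -> R) :
  eps K = 1 ->
  \sum_(s < K) 'C(K, s)%:R * (1 - eps s) ^+ (K - s) = beta ->
  (forall w : K.-tuple Delta,
     measurable (instability_set u (alg u uN w [set: 'I_K]%SET))) ->
  measurable [set w : K.-tuple Delta |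
     ((eps (min_compression_size u uN w))%:E
        < prob_instability P u (alg u uN w [set: 'I_K]%SET))%E] ->
  (forall I : {set 'I_K}, (#|I| < K)%N -> exists F : set (K.-tuple Delta),
    [/\ measurable F, (PK F <= ((1 - eps #|I|) ^+ (K - #|I|))%:E)%E &
      forall w, alg u uN w I = alg u uN w [set: 'I_K]%SET ->
       ((eps #|I|)%:E < P (instability_set u (alg u uN w [set: 'I_K]%SET)))%E ->
       F w]) ->
  (PK [set w : K.-tuple Delta |
     ((eps (min_compression_size u uN w))%:E
        < prob_instability P u (alg u uN w [set: 'I_K]%SET))%E] <= beta%:E)%E.
Proof.
move=> epsK hsum hmV hmE HF.
have /choice[F {}HF] (I : {set 'I_K}) : exists F : set (K.-tuple Delta),
    (#|I| < K)%N ->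
    [/\ measurable F, (PK F <= ((1 - eps #|I|) ^+ (K - #|I|))%:E)%E &
      forall w, alg u uN w I = alg u uN w [set: 'I_K]%SET ->
       ((eps #|I|)%:E < P (instability_set u (alg u uN w [set: 'I_K]%SET)))%E ->
       F w].
  by case: (boolP (#|I| < K)%N) => [/HF[G HG]|_]; [exists G|exists set0].
pose U := \big[setU/set0]_(I : {set 'I_K} | (#|I| < K)%N) F I.
have [mU PU] : measurable U /\ (PK U <= beta%:E)%E.
  rewrite -hsum -(@sum_subsets_by_card R K (fun s => (1 - eps s) ^+ (K - s))) -sumEFin.
  apply: (big_ind2 (fun A x => measurable A /\ (PK A <= x)%E)).
  - by rewrite measure0.
  - move=> A x B y [mA Ax] [mB By]; split; first exact: measurableU.
    by apply: le_trans (leeD Ax By); exact: measureU2.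
  - by move=> I /HF[].
apply: le_trans PU; apply: le_measure; rewrite ?inE //.
move=> w /= hw.
(* A probability is at most 1, so [eps K = 1] keeps multi-samples of compression size [K] out of the
   event; hence the sum stops at [K - 1]. *)
have lt1 : eps (min_compression_size u uN w) < 1.
  rewrite -lte_fin; apply: (lt_le_trans hw); exact: probability_le1.
have [sK|[I hI sI]] := min_compression_sizeP R N Delta u uN K w.
  by rewrite sK epsK ltxx in lt1.
have IK : (#|I| < K)%N.
  rewrite ltn_neqAle -[X in (_ <= X)%N]card_ord max_card andbT.
  by apply/eqP => IK; move: lt1; rewrite -sI IK epsK ltxx.
have [_ _ /(_ w hI)] := HF I IK; rewrite sI => /(_ hw) FIw.
by rewrite /U (bigD1 I) //; left.
Qed.

Theorem theorem1 (R : realType) (d : measure_display) (Delta : measurableType d)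
  (P : probability Delta R) (N : nat) (u : {set 'I_N} -> Delta -> R) (uN : R)
  (K : nat) (PK : probability (K.-tuple Delta) R)
  (* PK is the product probability P^K on Delta^K *)
  (hPK : forall A : 'I_K -> set Delta, (forall i, measurable (A i)) ->
     PK [set w | forall i, A i (tnth w i)] = (\prod_(i < K) P (A i))%E)
  (* the grand-coalition value does not depend on delta *)
  (huN : forall delta, u [set: 'I_N]%SET delta = uN)
  (* the scenario core is non-empty for every multi-sample *)
  (hne : forall w : K.-tuple Delta, alg u uN w [set: 'I_K]%SET !=set0)
  (beta : R) (hbeta : 0 < beta < 1)
  (eps : nat -> R) (heps01 : forall s, (s <= K)%N -> 0 <= eps s <= 1)
  (hepsK : eps K = 1)
  (hsum : \sum_(s < K) 'C(K, s)%:R * (1 - eps s) ^+ (K - s) = beta)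
  (* measurability of the events involved *)
  (hmV : forall w : K.-tuple Delta,
     measurable (instability_set u (alg u uN w [set: 'I_K]%SET)))
  (hmE : measurable [set w : K.-tuple Delta |
     ((eps (min_compression_size u uN w))%:E
        < prob_instability P u (alg u uN w [set: 'I_K]%SET))%E]) :
  (PK [set w : K.-tuple Delta |
     ((eps (min_compression_size u uN w))%:E
        < prob_instability P u (alg u uN w [set: 'I_K]%SET))%E] <= beta%:E)%E.
Proof.
apply: compression_union_bound => // I IK.
(* For [K <= 1] a multi-sample cannot hold two points. But then [I] is empty, its core is constant,
   and [hmV] gives measurability as soon as [I] compresses some multi-sample; otherwise [F] is
   empty. *)
have [K1|K1] := leqP K 1.
  have I0 : I = finset.set0.
    by apply/eqP; rewrite -cards_eq0 -leqn0 -ltnS; exact: leq_trans K1.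
  have [[w0 hw0]|nw0] := pselect (exists w, alg u uN w I = alg u uN w [set: 'I_K]%SET).
    have algI w : alg u uN w I = alg u uN w0 I.
      by apply: eq_alg => i; rewrite I0 inE.
    have [||||F [mF PF HF]] := compression_bound R d Delta P K PK hPK I
      (fun=> instability_set u (alg u uN w0 I)) (eps #|I|).
    - by [].
    - by move=> _; rewrite hw0; exact: hmV.
    - move=> j _; rewrite -[X in measurable X]setTI.
      by apply: measurable_tnth; rewrite ?hw0.
    - by apply: heps01; exact: ltnW.
    exists F; split => // w hw hV; apply: HF => [|j _].
      by rewrite -(algI w) hw.
    by rewrite -(algI w) hw; exact: sample_stable.
  by exists set0; split => // [|w hw _]; [rewrite measure0 lee_fin exprn_ge0 // subr_ge0; have /andP[] := heps01 _ (ltnW IK)|exfalso; apply: nw0; exists w].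
have hne1 delta : scenario_core u uN [set delta] !=set0.
  have [x /algP[xN xu]] := hne [tuple delta | i < K].
  exists x; split => // S ST _ ->.
  by have := xu S (Ordinal (ltnW K1)) ST; rewrite tnth_mktuple inE; apply.
have mt S (ST : S != [set: 'I_N]%SET) :=
  measurable_tight R d Delta N u uN K S K1 hne1 hne hmV ST.
have algt w (I' : {set 'I_K}) : alg (tight u uN) uN w I' = alg u uN w I'.
  exact: scenario_core_tight.
have inst w (I' : {set 'I_K}) : instability_set (tight u uN) (alg u uN w I') =
    instability_set u (alg u uN w I').
  exact: instability_set_tight.
(* [hmV] concerns full cores; for cores over [I], and jointly in the samples, measurability is read
   off the tightened game. *)
have [||||F [mF PF HF]] := compression_bound R d Delta P K PK hPK I
  (fun w => instability_set u (alg u uN w I)) (eps #|I|).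
- by move=> w w' /eq_alg ->.
- by move=> w; rewrite -inst; exact: measurable_instability_set.
- move=> j _; have := @measurable_sample_instability R d Delta N (tight u uN) uN K I j mt.
  rewrite (_ : [set w | _] = [set w | instability_set u (alg u uN w I) (tnth w j)]).
    by apply=> w; rewrite algt; have [x /alg_subset hx] := hne w; exists x.
  by apply/funext => w /=; rewrite algt inst.
- by apply: heps01; exact: ltnW.
exists F; split => // w hw hV; apply: HF => [|j _]; rewrite hw //.
exact: sample_stable.
Qed.
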